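(* Let $\mathbf{A} \in \mathbb{R}^{M\times N}$ have full row rank, let $\mathbf{A}^\dagger = \mathbf{A}^\top (\mathbf{A}\mathbf{A}^\top)^{-1} \in \mathbb{R}^{N\times M}$, and let $\mathbf{y} \in \mathbb{R}^M$. For any $z \in \mathbb{R}^N$ define $$z' = z - \mathbf{A}^\dagger(\mathbf{A} z - \mathbf{y}).$$ Then: (i) $z'$ satisfies the consistency constraint $\mathbf{A} z' = \mathbf{y}$. (ii) The mapping $z \mapsto z'$ is a minimal perturbation: $z' = \arg\min_{w \in \mathcal{M}_{\mathbf{A},\mathbf{y}}} \|w - z\|_2$. (iii) $z'$ and $z$ have the same null component, i.e. $(\mathbf{I} - \mathbf{A}^\dagger\mathbf{A})z' = (\mathbf{I} - \mathbf{A}^\dagger\mathbf{A})z$.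
   Context: $\mathbf{I}$ is the $N\times N$ identity matrix and $\|\cdot\|_2$ is the Euclidean norm on $\mathbb{R}^N$. The consistency constraint set is the affine subspace $\mathcal{M}_{\mathbf{A},\mathbf{y}} = \{ w \in \mathbb{R}^N : \mathbf{A} w = \mathbf{y}\}$. Since $\mathbf{A}$ has full row rank, $\mathbf{A}^\dagger$ is its Moore-Penrose pseudoinverse. The null component of a vector $z\in\mathbb{R}^N$ (with respect to $\mathbf{A}$) is $(\mathbf{I}-\mathbf{A}^\dagger\mathbf{A})z$, the second term in the decomposition $z = \mathbf{A}^\dagger\mathbf{A}z + (\mathbf{I}-\mathbf{A}^\dagger\mathbf{A})z$. *)

(* Defs.v *)
From mathcomp Require Import all_boot all_order all_algebra.
From mathcomp Require Import classical_sets reals.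

Set Implicit Arguments.
Unset Strict Implicit.
Unset Printing Implicit Defensive.

Import Order.TTheory GRing.Theory Num.Theory.

Local Open Scope ring_scope.
Local Open Scope classical_set_scope.

Definition enorm (R : realType) (n : nat) (v : 'cV[R]_n) : R :=
  Num.sqrt (\sum_(i < n) v i 0 ^+ 2).

(* [A *m A^T] is invertible exactly when [A] has full row rank; otherwise
   [invmx] returns its argument and [pinv A] is not the pseudoinverse of [A]. *)
Definition pinv (R : realType) (m n : nat) (A : 'M[R]_(m, n)) : 'M[R]_(n, m) :=
  A^T *m invmx (A *m A^T).

Definition consistency_set (R : realType) (m n : nat)
    (A : 'M[R]_(m, n)) (y : 'cV[R]_m) : set 'cV[R]_n :=
  [set w | A *m w = y].

(* The set of all minimizers: "x = arg min" is read as [argmin D f = [set x]],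
   i.e. [x] is the unique minimizer of [f] on [D]. *)
Definition argmin (R : realType) (T : Type) (D : set T) (f : T -> R) : set T :=
  [set x | D x /\ forall w, D w -> f x <= f w].

(* Main.v *)
Require Import Defs.
From mathcomp Require Import all_boot all_order all_algebra.
From mathcomp Require Import classical_sets reals.

Import Order.TTheory GRing.Theory Num.Theory.

Local Open Scope ring_scope.
Local Open Scope classical_set_scope.

(** The correction [z' - z] lies in the range of [A^T], which is orthogonal to
    the kernel of [A]; so [|w - z|^2 = |w - z'|^2 + |z' - z|^2] for every
    consistent [w], and [z'] is the unique minimizer. *)

Lemma sqr_enorm (R : realType) (n : nat) (v : 'cV[R]_n) :
  enorm v ^+ 2 = (v^T *m v) 0 0.
Proof.
rewrite sqr_sqrtr; last by apply: sumr_ge0 => i _; exact: sqr_ge0.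
by rewrite mxE; apply: eq_bigr => i _; rewrite mxE expr2.
Qed.

Lemma enorm_ge0 (R : realType) (n : nat) (v : 'cV[R]_n) : 0 <= enorm v.
Proof. exact: sqrtr_ge0. Qed.

Lemma enorm_eq0 (R : realType) (n : nat) (v : 'cV[R]_n) :
  enorm v = 0 -> v = 0.
Proof.
(* [Num.sqrt] is 0 on negative reals too, so this yields only that the sum of squares is at most
   0. *)
move/eqP; rewrite sqrtr_eq0 => le0.
have : \sum_(i < n) v i 0 ^+ 2 == 0.
  by rewrite eq_le le0 sumr_ge0 // => i _; exact: sqr_ge0.
rewrite psumr_eq0 => [/allP h|i _]; last exact: sqr_ge0.
apply/colP => i; apply/eqP; rewrite mxE -sqrf_eq0.
exact: h (mem_index_enum i).
Qed.

(** If [u *m (A *m A^T) = 0], multiplying by [u^T] on the right shows that [u *m A] has norm 0; so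
    [u *m A = 0], and [u = 0] because the rows of [A] are free. This is applied to each row of the
    kernel matrix. *)
Lemma gram_unitmx (R : realType) (m n : nat) (A : 'M[R]_(m, n)) :
  row_free A -> A *m A^T \in unitmx.
Proof.
move=> freeA; rewrite -row_free_unit -kermx_eq0; apply/eqP/row_matrixP => i.
set u := row i _; rewrite row0.
have uG0 : u *m (A *m A^T) = 0 by apply/sub_kermxP; exact: row_sub.
have/enorm_eq0 : enorm (u *m A)^T = 0.
  apply/eqP; rewrite -sqrf_eq0 sqr_enorm trmxK trmx_mul.
  by rewrite !mulmxA -(mulmxA u) uG0 mul0mx mxE.
move/(congr1 trmx); rewrite trmxK trmx0 => uA0.
by apply: (row_free_inj freeA); rewrite uA0 mul0mx.
Qed.

Lemma mulmx_pinv (R : realType) (m n : nat) (A : 'M[R]_(m, n)) :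
  row_free A -> A *m pinv A = 1%:M.
Proof. by move=> freeA; rewrite mulmxA mulmxV ?gram_unitmx. Qed.

Lemma sqr_enormD_orth (R : realType) (n : nat) (u v : 'cV[R]_n) :
  u^T *m v = 0 -> enorm (u + v) ^+ 2 = enorm u ^+ 2 + enorm v ^+ 2.
Proof.
move=> uv0; have vu0 : v^T *m u = 0.
  by rewrite -[v^T *m u]trmxK trmx_mul trmxK uv0 trmx0.
by rewrite !sqr_enorm [(u + v)^T]linearD /= mulmxDl !mulmxDr uv0 vu0 addr0 add0r mxE.
Qed.

Theorem lemma4p2 (R : realType) (M N : nat) (A : 'M[R]_(M, N))
    (y : 'cV[R]_M) (z : 'cV[R]_N) (hA : row_free A) :
  let z' := z - pinv A *m (A *m z - y) in
  [/\ A *m z' = y,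
      argmin (consistency_set A y) (fun w => enorm (w - z)) = [set z'] &
      (1%:M - pinv A *m A) *m z' = (1%:M - pinv A *m A) *m z].
Proof.
move=> z'.
have Az' : A *m z' = y.
  by rewrite mulmxBr mulmxA mulmx_pinv // mul1mx opprB addrC subrK.
have pythagoras w : A *m w = y ->
    enorm (w - z) ^+ 2 = enorm (w - z') ^+ 2 + enorm (z' - z) ^+ 2.
  move=> Aw; rewrite -[w - z](subrKA z') (sqr_enormD_orth _ _ (w - z')) //.
  have -> : z' - z = - (pinv A *m (A *m z - y)) by rewrite addrAC subrr add0r.
  (* The leading [A^T] of [pinv A] meets [(w - z')^T], and their product is the transpose of
     [A *m (w - z') = y - y = 0]. *)
  rewrite mulmxN /pinv !mulmxA.
  by rewrite -trmx_mul [A *m (w - z')]mulmxBr Aw Az' subrr trmx0 !mul0mx oppr0.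
split=> //.
- apply/seteqP; split=> [w [Aw wmin]|_ ->].
  (* Uniqueness: comparing a minimizer [w] with [z'] itself, [pythagoras] leaves
     [enorm (w - z') ^+ 2 <= 0]. *)
  + apply/eqP; rewrite -subr_eq0; apply/eqP/enorm_eq0/eqP; rewrite -sqrf_eq0.
    have := wmin z' Az'; rewrite -ler_sqr ?nnegrE ?enorm_ge0 // pythagoras //.
    by rewrite gerDr => le0; rewrite eq_le le0 sqr_ge0.
  + split=> // w Aw; rewrite -ler_sqr ?nnegrE ?enorm_ge0 // (pythagoras w) //.
    by rewrite lerDr sqr_ge0.
(* By [Az'] the left side is [z' - pinv A *m y]; expanding [z'] cancels [pinv A *m y]. *)
- rewrite !mulmxBl !mul1mx -!(mulmxA (pinv A)) Az' /z' mulmxBr opprB -addrA; congr (_ + _).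
  by rewrite addrAC subrr add0r.
Qed.
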